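(* Let $q$ be an odd prime power and let $f\in\mathbb{F}_q[x]$ be a dynamically $2$-ordinary polynomial of degree $d$. Let $a\in\mathbb{F}_q$. Suppose the sequence $s_a=(\chi(f^{\ell}(a)))_{\ell\geq 1}$ is periodic, and let $m$ be its period. Then \[|\mathcal{O}_f(a)|=O\left(m\,q^{\frac{2\log_2(d)+1}{2\log_2(d)+2}}\right),\] where the implied constant depends only on $d$.
   Context: $f^n$ denotes the $n$-th iterate of $f$ ($f^0=x$), and $\deg f\geq 2$. $f$ is dynamically $2$-ordinary if for every $n\geq 1$ there is an irreducible factor $g_n\in\mathbb{F}_q[x]$ of $f^n$ with odd multiplicity in $f^n$ such that $g_n$ does not divide $f^i$ for any $0\leq i<n$. $\chi$ is the quadratic character of $\mathbb{F}_q$ (with $\chi(0)=0$). $\mathcal{O}_f(a)=\{a,f(a),f^2(a),\dots\}$ is the forward orbit of $a$. *)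

(* Defs.v *)
From HB Require Import structures.
From mathcomp Require Import all_boot all_order all_algebra.
From mathcomp Require Import reals exp.

Set Implicit Arguments.
Unset Strict Implicit.
Unset Printing Implicit Defensive.

Import Order.TTheory GRing.Theory Num.Theory.

Local Open Scope ring_scope.

Definition poly_iter (F : fieldType) (f : {poly F}) (n : nat) : {poly F} :=
  iter n (fun g => f \Po g) 'X.

Lemma horner_poly_iter (F : fieldType) (f : {poly F}) (n : nat) (x : F) :
  (poly_iter f n).[x] = iter n (horner f) x.
Proof. by elim: n => [|n IHn] /=; rewrite ?hornerX // horner_comp IHn. Qed.

(* Intended for g nonconstant and p nonzero, where k is then unique. *)
Definition has_multiplicity (F : fieldType) (g p : {poly F}) (k : nat) : bool :=
  (g ^+ k %| p) && ~~ (g ^+ k.+1 %| p).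

Definition dynamically_2_ordinary (F : fieldType) (f : {poly F}) : Prop :=
  forall n : nat, (1 <= n)%N ->
  exists g : {poly F},
    [/\ irreducible_poly g,
        g %| poly_iter f n,
        exists2 k : nat, odd k & has_multiplicity g (poly_iter f n) k
      & forall i : nat, (i < n)%N -> ~~ (g %| poly_iter f i)].

Definition quad_char (F : finFieldType) (x : F) : int :=
  if x == 0 then 0 else if [exists y : F, y ^+ 2 == x] then 1 else -1.

(* Sequences are indexed by l >= 1; the term of index 0 is ignored.  Periodicity
   is pure: every finite-orbit sequence is trivially eventually periodic. *)
Definition is_period (T : Type) (s : nat -> T) (m : nat) : Prop :=
  (0 < m)%N /\ forall l : nat, (1 <= l)%N -> s (l + m)%N = s l.

Definition least_period (T : Type) (s : nat -> T) (m : nat) : Prop :=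
  is_period s m /\ forall m' : nat, is_period s m' -> (m <= m')%N.

Definition log2 (R : realType) (x : R) : R := ln x / ln 2.

(* Main.v *)
(**
  Let q = #|F| and let s_l be the value of the quadratic character at f^l(a).  By periodicity
  every point x = f^(jm)(a) satisfies chi(f^i(x)) = s_i for all i >= 1, and the orbit of a is
  the union of the images of the set of these points under f^0, ..., f^(m-1).  If some s_i is 0
  the orbit revisits 0 after m steps and has at most 2m points.  Otherwise, the number of x
  with chi(f^i(x)) = s_i for 1 <= i <= k is at most the average over I of
  |sum_x chi(prod_(i in I) f^i(x))|, where I runs through the subsets of {1, ..., k}.
  For I nonempty the product has an irreducible factor of odd multiplicity, namely the one
  attached to max I, so a Weil type estimate bounds the sum by O(d^k sqrt q).  Hence
  2^k |orbit| <= m (q + O((2d)^k sqrt q)), and one takes k maximal with (2d)^k <= sqrt q.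

  The Weil type estimate is obtained by Stepanov's method: one constructs a nonzero
  P = A(X, X^q) + B(X, X^q) f^((q-1)/2) of small degree that vanishes to order about sqrt q
  at every x with f(x)^((q-1)/2) = eps.  It is nonzero because P = 0 would force
  A(X, Y)^2 f(X) = B(X, Y)^2 f(Y), and comparing leading coefficients in Y would make f a
  square up to a constant factor.
*)

Require Import Defs.
From HB Require Import structures.
From mathcomp Require Import all_boot all_order all_algebra.
From mathcomp Require Import reals exp.
From mathcomp Require Import all_fingroup all_solvable all_field.
From mathcomp Require Import zify ring lra.

Set Implicit Arguments.
Unset Strict Implicit.
Unset Printing Implicit Defensive.

Import Order.TTheory GRing.Theory Num.Theory.

Local Open Scope ring_scope.

(** * Hasse derivatives *)

Lemma nderivnM (R : comNzRingType) (p q : {poly R}) (n : nat) :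
  (p * q)^`N(n) = \sum_(i < n.+1) p^`N(i) * q^`N(n - i).
Proof.
elim/poly_ind: p n => [|p c IHp] n.
  by rewrite mul0r linear0 big1 // => i _; rewrite linear0 mul0r.
have derX (r : {poly R}) k : (r * 'X)^`N(k.+1) = r^`N(k) + r^`N(k.+1) * 'X.
  by rewrite -[r * 'X]addr0 -[0]/(0%:P) nderivnMXaddC.
have -> : ((p * 'X + c%:P) * q)^`N(n) = (p * q * 'X)^`N(n) + c%:P * q^`N(n).
  by rewrite mulrDl nderivnD mulrAC mul_polyC nderivnZ mul_polyC.
case: n => [|n].
  by rewrite big_ord1 !nderivn0 mulrAC -mulrDl.
have E : \sum_(i < n.+1) (p * 'X + c%:P)^`N(lift ord0 i) * q^`N(n.+1 - lift ord0 i)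
       = \sum_(i < n.+1) p^`N(i) * q^`N(n - i)
         + (\sum_(i < n.+1) p^`N(lift ord0 i) * q^`N(n.+1 - lift ord0 i)) * 'X.
  rewrite mulr_suml -big_split; apply: eq_bigr => i _ /=.
  by rewrite nderivnMXaddC subSS mulrDl mulrAC.
rewrite derX !IHp [RHS]big_ord_recl E big_ord_recl [in X in _ + X * 'X]big_ord_recl.
rewrite !nderivn0 subn0; ring.
Qed.

(** By Taylor expansion at [x]. Hasse derivatives are used because ordinary ones fail to detect
    multiplicities beyond the characteristic. *)
Lemma dvdp_XsubC_exp_nderivn (F : fieldType) (p : {poly F}) (x : F) (M : nat) :
  (forall l, (l < M)%N -> (p^`N(l)).[x] = 0) -> ('X - x%:P) ^+ M %| p.
Proof.
move=> px0; have -> : p = p^:P.[x%:P + ('X - x%:P)].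
  by rewrite addrC subrK -[_.[_]]/(p \Po 'X) comp_polyXr.
rewrite nderiv_taylor; last exact: mulrC.
apply: (big_ind (fun u => _ %| u)); [exact: dvdp0 | exact: dvdp_add |].
move=> i _; rewrite nderivn_map horner_map /=.
have [/px0->|leMi] := ltnP i M; first by rewrite mul0r dvdp0.
by apply: dvdp_mull; rewrite dvdp_exp2l.
Qed.

Lemma size_nderivn_leq (R : nzSemiRingType) (p : {poly R}) l : (size p^`N(l) <= size p - l)%N.
Proof. exact: size_poly. Qed.

(** Higher logarithmic derivatives: the quotient of the l-th Hasse derivative of [w] by [w] is a
    fraction [r / f ^+ l] whose numerator has degree at most [l * D], however large the degree of
    [w]. This lets [f ^+ h] enter the linear algebra at low cost. *)
Definition log_hasse (F : fieldType) (f : {poly F}) (D M : nat) (w : {poly F}) :=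
  forall l, (l < M)%N -> exists2 r : {poly F},
    (size r <= (l * D).+1)%N & w^`N(l) * f ^+ l = w * r.

Section LogHasse.
Variables (F : fieldType) (f : {poly F}) (D M : nat).

Lemma log_hasse1 : log_hasse f D M 1.
Proof.
move=> l _; exists (if l is 0 then 1 else 0); first by case: l => *; rewrite ?size_poly0 ?size_poly1.
by rewrite -[1]/(1%:P) nderivnC; case: l => [|l]; rewrite ?expr0 ?mul0r ?mulr0.
Qed.

(** By the Leibniz rule, where the degree bounds [i * D] and [(l - i) * D] add up to [l * D]. *)
Lemma log_hasseM (u v : {poly F}) :
  log_hasse f D M u -> log_hasse f D M v -> log_hasse f D M (u * v).
Proof.
move=> hu hv l ltlM.
(* Boolean form, so that [xchoose] selects a family of numerators without a choice axiom. *)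
pose P k (u r : {poly F}) := (size r <= (k * D).+1)%N && (u^`N(k) * f ^+ k == u * r).
have exP u' : log_hasse f D M u' -> exists r : nat -> {poly F}, forall k, (k <= l)%N -> P k u' (r k).
  move=> hu'; have ex k : exists r, (k <= l)%N ==> P k u' r.
    case: (leqP k l) => [lekl|_]; last by exists 0.
    by have [r sr Er] := hu' k (leq_ltn_trans lekl ltlM); exists r; rewrite /P sr Er eqxx.
  by exists (fun k => xchoose (ex k)) => k lekl; exact: (implyP (xchooseP (ex k))).
have [r hr] := exP u hu; have [s hs] := exP v hv.
exists (\sum_(i < l.+1) r i * s (l - i)%N).
  apply: (leq_trans (size_sum _ _ _)); apply/bigmax_leqP => i _.
  have leil : (i <= l)%N by rewrite -ltnS.
  have /andP[sr _] := hr i leil; have /andP[ss _] := hs (l - i)%N (leq_subr _ _).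
  apply: (leq_trans (size_polyMleq _ _)).
  have -> : (l * D = i * D + (l - i) * D)%N by rewrite -mulnDl subnKC.
  lia.
rewrite nderivnM mulr_suml mulr_sumr; apply: eq_bigr => i _.
have leil : (i <= l)%N by rewrite -ltnS.
have /andP[_ /eqP Er] := hr i leil; have /andP[_ /eqP Es] := hs (l - i)%N (leq_subr _ _).
have -> : f ^+ l = f ^+ i * f ^+ (l - i) by rewrite -exprD subnKC.
by rewrite mulrACA Er Es mulrACA.
Qed.

Lemma log_hasseX (u : {poly F}) n : log_hasse f D M u -> log_hasse f D M (u ^+ n).
Proof.
move=> hu; elim: n => [|n IHn]; first by rewrite expr0; exact: log_hasse1.
by rewrite exprS; exact: log_hasseM.
Qed.

Lemma log_hasse_self : (size f <= D.+1)%N -> log_hasse f D M f.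
Proof.
move=> sf [|l] _; first by exists 1; rewrite ?size_poly1 // nderivn0 expr0.
exists (f^`N(l.+1) * f ^+ l); last by rewrite exprS !mulrA [_ * f]mulrC.
apply: (leq_trans (size_polyMleq _ _)).
have := size_nderivn_leq f l.+1; have := size_poly_exp_leq f l.
have : ((size f).-1 * l <= l * D)%N by rewrite mulnC leq_mul2l; lia.
rewrite mulSn; lia.
Qed.

End LogHasse.

(** * Frobenius on polynomials and Hasse derivatives of powers of X^q *)

Lemma pchar_nat_card (F : finFieldType) : [pchar {poly F}].-nat #|F|.
Proof.
have [p pr_p pF] := finPcharP F.
have : p.-nat #|F|.
  by rewrite -cardsT; apply: abelem_pgroup; exact: fin_ring_pchar_abelem.
apply: sub_in_pnat => r _; rewrite inE => /eqP->.
by rewrite pchar_poly.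
Qed.

(** Frobenius is additive and fixes the coefficients, which lie in the field with q elements. *)
Lemma expr_card_poly (F : finFieldType) (p : {poly F}) : p ^+ #|F| = p \Po 'X^#|F|.
Proof.
elim/poly_ind: p => [|p c IHp].
  by rewrite comp_poly0 expr0n (gtn_eqF (ltnW (finNzRing_gt1 F))).
rewrite exprDn_pchar ?pchar_nat_card // exprMn IHp -polyC_exp expf_card.
by rewrite comp_polyD comp_polyM comp_polyX comp_polyC.
Qed.

(** Compares coefficients in (1 + X)^q = 1 + X^q. *)
Lemma bin_card_eq0 (F : finFieldType) l : (0 < l < #|F|)%N -> 'C(#|F|, l)%:R = 0 :> F.
Proof.
case/andP=> l0 lq.
have : (1 + 'X : {poly F}) ^+ #|F| = 1 + 'X ^+ #|F|.
  by rewrite exprDn_pchar ?pchar_nat_card // expr1n.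
move/(congr1 (fun p : {poly F} => p`_l)); rewrite exprDn coef_sum.
rewrite coefD coef1 coefXn (gtn_eqF l0) (ltn_eqF lq) addr0.
have ll : (l < #|F|.+1)%N by exact: ltnW.
rewrite (bigD1 (Ordinal ll)) //= expr1n mul1r coefMn coefXn eqxx.
rewrite big1 ?addr0 // => i /negPf ne; rewrite expr1n mul1r coefMn coefXn.
by rewrite -val_eqE /= in ne; rewrite eq_sym ne mul0rn.
Qed.

(** The Hasse derivatives of X^q of orders strictly between 0 and q vanish, so its powers behave
    like constants. *)
Lemma log_hasse_Xcard (F : finFieldType) (f : {poly F}) D M j :
  (M <= #|F|)%N -> log_hasse f D M ('X^(#|F| * j)).
Proof.
move=> leM; rewrite exprM; apply: log_hasseX => l ltl.
exists (if l is 0 then 1 else 0); first by case: l ltl => *; rewrite ?size_poly0 ?size_poly1.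
rewrite nderivnXn; case: l ltl => [|l] ltl; first by rewrite bin0 subn0 mulr1n expr0.
rewrite -mulr_natr -polyC_natr bin_card_eq0 ?mulr0 ?mul0r //=.
exact: leq_trans ltl leM.
Qed.

(** * Stepanov's method *)

Lemma nontrivial_kernel (K : fieldType) (U V : vectType K) (phi : {linear U -> V}) :
  (dim V < dim U)%N -> exists2 u, u != 0 & phi u = 0.
Proof.
move=> ltVU; pose k := lker (linfun phi); exists (vpick k); last first.
  by have := memv_pick k; rewrite memv_ker lfunE => /eqP.
rewrite vpick0; apply: contraTneq ltVU => k0; rewrite -leqNgt -!dimvf.
by rewrite -(limg_ker_dim (linfun phi) fullv) -/k k0 capv0 dimv0 add0n dimvS ?subvf.
Qed.

(* Since w_i = e_i on S, the l-th Hasse derivative of sum_i a_i w_i agrees on S, up to the factor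
   f ^ l, with a polynomial of degree less than A + J + M D depending linearly on the a_i.
   Requiring these polynomials to vanish identically gives fewer equations than unknowns. *)
Lemma auxiliary_poly (F : fieldType) (n A D J M : nat) (f : {poly F})
    (w e : 'I_n -> {poly F}) (S : pred F) :
  (size f <= D.+1)%N ->
  (forall i, log_hasse f D M (w i)) ->
  (forall i, (size (e i) <= J)%N) ->
  (forall x, S x -> f.[x] != 0 /\ forall i, (w i).[x] = (e i).[x]) ->
  (M * (A + J + M * D) < n * A)%N ->
  exists a : 'I_n -> {poly F},
    [/\ exists i, a i != 0, forall i, (size (a i) <= A)%N
      & forall x, S x -> ('X - x%:P) ^+ M %| \sum_i a i * w i].
Proof.
move=> sf hw se hS ltMn; set N := (A + J + M * D)%N in ltMn.
pose good i l (r : {poly F}) :=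
  (size r <= (l * D).+1)%N && ((w i)^`N(l) * f ^+ l == w i * r).
have exr i l : exists r, (l < M)%N ==> good i l r.
  case: ltnP => [ltlM|_]; last by exists 0.
  by have [r sr Er] := hw i l ltlM; exists r; rewrite /good sr Er eqxx.
pose r i l := xchoose (exr i l).
have rP i l : (l < M)%N -> good i l (r i l) by exact: (implyP (xchooseP (exr i l))).
(* By the Leibniz rule, this is [f ^+ l] times the l-th Hasse derivative of the combination, with
   each outer factor [w i] replaced by [e i]. *)
pose Q l (a : 'I_n -> {poly F}) :=
  \sum_i e i * \sum_(k < l.+1) (a i)^`N(k) * f ^+ k * r i (l - k)%N.
pose a (v : 'M[F]_(n, A)) i := rVpoly (row i v).
pose phi (v : 'M[F]_(n, A)) : 'M[F]_(M, N) := \matrix_(l < M) poly_rV (Q l (a v)).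
have phi_lin : linear phi.
  move=> c u v; apply/row_matrixP => l; rewrite linearP /= !rowK -linearP /=.
  congr poly_rV; rewrite /Q scaler_sumr -big_split; apply: eq_bigr => i _ /=.
  rewrite scalerAr -mulrDr scaler_sumr -big_split; congr (_ * _).
  apply: eq_bigr => k _ /=; rewrite /a !linearP /= !mulrDl !scalerAl.
  by [].
pose Phi := GRing.isLinear.Build _ _ _ _ phi phi_lin.
pose phiL : {linear 'M[F]_(n, A) -> 'M[F]_(M, N)} := HB.pack phi Phi.
have [v v0 phiv0] := @nontrivial_kernel F _ _ phiL ltMn.
have sa i : (size (a v i) <= A)%N by exact: size_poly.
have Q0 l : (l < M)%N -> Q l (a v) = 0.
  move=> ltlM; have := congr1 (row (Ordinal ltlM)) phiv0.
  rewrite rowK row0 => /(congr1 rVpoly); rewrite linear0 poly_rV_K //=.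
  apply: (leq_trans (size_sum _ _ _)); apply/bigmax_leqP => i _.
  apply: (leq_trans (size_polyMleq _ _)).
  set s := \sum_(k < _) _; have : (size s <= A + l * D)%N.
    apply: (leq_trans (size_sum _ _ _)); apply/bigmax_leqP => k _.
    have lekl : (k <= l)%N by rewrite -ltnS.
    have /andP[sr _] := rP i (l - k)%N (leq_ltn_trans (leq_subr _ _) ltlM).
    apply: (leq_trans (size_polyMleq _ _)).
    have := size_polyMleq (a v i)^`N(k) (f ^+ k).
    have := size_nderivn_leq (a v i) k; have := size_poly_exp_leq f k.
    have : ((size f).-1 * k <= k * D)%N by rewrite mulnC leq_mul2l; lia.
    have -> : (l * D = k * D + (l - k) * D)%N by rewrite -mulnDl subnKC.
    by have := sa i; lia.
  have : (l * D <= M * D)%N by rewrite leq_mul2r ltnW ?orbT.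
  by have := se i; rewrite /N; lia.
exists (a v); split=> // [|x Sx].
  apply/existsP; apply: contraNT v0; rewrite negb_exists => /forallP a0.
  apply/eqP/row_matrixP => i; rewrite row0; apply: (can_inj (@rVpolyK _ _)).
  by rewrite linear0; apply/eqP; rewrite -[_ == _]negbK; exact: a0.
apply: dvdp_XsubC_exp_nderivn => l ltlM.
have [fx wx] := hS x Sx; apply: (mulIf (expf_neq0 l fx)).
rewrite mul0r -horner_exp -hornerM.
transitivity (Q l (a v)).[x]; last by rewrite Q0 // horner0.
rewrite linear_sum mulr_suml /Q !horner_sum; apply: eq_bigr => i _.
rewrite /= nderivnM mulr_suml hornerM -wx -hornerM mulr_sumr.
congr (horner _ x); apply: eq_bigr => k _.
have lekl : (k <= l)%N by rewrite -ltnS.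
have /andP[_ /eqP Er] := rP i (l - k)%N (leq_ltn_trans (leq_subr _ _) ltlM).
have -> : f ^+ l = f ^+ k * f ^+ (l - k) by rewrite -exprD subnKC.
by rewrite mulrACA Er mulrCA !mulrA.
Qed.

(** Powers of ['X - x%:P] at distinct points are coprime, so their product divides [p]. *)
Lemma card_mul_leq_size (F : finFieldType) (S : {set F}) (M : nat) (p : {poly F}) :
  p != 0 -> (forall x, x \in S -> ('X - x%:P) ^+ M %| p) -> (#|S| * M < size p)%N.
Proof.
move=> p0 hS; have dvd s : uniq s -> {subset s <= S} ->
    \prod_(x <- s) ('X - x%:P) ^+ M %| p.
  elim: s => [|x s IHs] /=; first by rewrite big_nil dvd1p.
  case/andP=> xs us sS; rewrite big_cons Gauss_dvdp; last first.
    apply: coprimep_expl; rewrite coprimep_sym coprimep_XsubC /root horner_prod.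
    rewrite prodf_seq_neq0; apply/allP => y ys /=.
    by rewrite horner_exp expf_neq0 // hornerXsubC subr_eq0; apply: contraNneq xs => ->.
  rewrite hS ?sS ?mem_head //= IHs // => y ys.
  by apply: sS; rewrite inE ys orbT.
have sub : {subset enum S <= S} by move=> x; rewrite mem_enum.
have := dvdp_leq p0 (dvd (enum S) (enum_uniq _) sub).
rewrite size_prod_seq => [|x _]; last by rewrite expf_neq0 // polyXsubC_eq0.
under eq_bigr do rewrite size_exp_XsubC.
rewrite big_const_seq count_predT iter_addn_0 -cardE mulSn -addnS addKn.
by rewrite mulnC.
Qed.

(** * Irreducible factors and parity of multiplicities *)

Section IrreducibleFactor.
Variables (F : fieldType) (g : {poly F}).
Hypothesis g_irr : irreducible_poly g.

Lemma irredp_coprimep (p : {poly F}) : coprimep g p = ~~ (g %| p).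
Proof.
have g1 : size g != 1 by rewrite gtn_eqF // g_irr.1.
apply/idP/idP => [cop|ndvd].
  apply/negP => gp; move: cop; rewrite coprimep_def.
  by rewrite (eqp_size (dvdp_gcd_idl gp)) (negPf g1).
rewrite coprimep_def; apply: contraNT ndvd => /g_irr.2 /(_ (dvdp_gcdl _ _)) e.
by rewrite -(eqp_dvdl _ e) dvdp_gcdr.
Qed.

Lemma irredp_dvdpM (p q : {poly F}) : (g %| p * q) = (g %| p) || (g %| q).
Proof.
by apply: negb_inj; rewrite negb_or -!irredp_coprimep coprimepMr.
Qed.

Lemma factor_out (p : {poly F}) : p != 0 ->
  exists i p', ~~ (g %| p') /\ p = p' * g ^+ i.
Proof.
move: {2}(size p) (leqnn (size p)) => n; elim: n p => [|n IHn] p sp p0.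
  by move: sp; rewrite leqn0 size_poly_eq0 (negPf p0).
have [/dvdpP[p1 Ep]|ndvd] := boolP (g %| p); last first.
  by exists 0%N, p; rewrite expr0 mulr1.
have p10 : p1 != 0 by apply: contraNneq p0 => p10; rewrite Ep p10 mul0r.
have [|i [p' [ndvd Ep1]]] := IHn p1 _ p10; last first.
  by exists i.+1, p'; rewrite Ep Ep1 exprSr mulrA.
move: sp; rewrite Ep size_mul // ?irredp_neq0 //.
by have := g_irr.1; move: (size p1) (size g) => a b; lia.
Qed.

(** If i < j, cancelling [g ^+ i] leaves a factor [g] in [u]. *)
Lemma factor_out_uniq (u v : {poly F}) i j :
  ~~ (g %| u) -> ~~ (g %| v) -> u * g ^+ i = v * g ^+ j -> i = j.
Proof.
wlog leij : i j u v / (i <= j)%N => [th|nu nv E].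
  have [|/ltnW] := leqP i j; first exact: th.
  by move=> leji nu nv E; apply/esym/(th _ _ v u).
apply/eqP; rewrite eqn_leq leij leqNgt; apply/negP => ltij.
move: E; rewrite -(subnKC leij) exprD mulrCA mulrC.
move/(mulfI (expf_neq0 _ (irredp_neq0 g_irr))) => Eu; move: nu.
by rewrite Eu dvdp_mull // dvdp_exp // subn_gt0.
Qed.

(** The multiplicity of [g] is odd on the left and even on the right. *)
Lemma odd_multiplicity_not_square (f alpha beta : {poly F}) (c : F) e :
  odd e -> has_multiplicity g f e -> alpha != 0 -> c != 0 ->
  alpha ^+ 2 * f <> beta ^+ 2 * c%:P.
Proof.
move=> odd_e /andP[/dvdpP[f' Ef] ndvd] a0 c0 E.
have nf' : ~~ (g %| f').
  apply: contra ndvd => /dvdpP[f'' Ef']; rewrite Ef Ef' -mulrA -exprS.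
  exact: dvdp_mull.
have f0 : f != 0 by apply: contraNneq ndvd => ->; rewrite dvdp0.
have b0 : beta != 0.
  apply: contraTneq (mulf_neq0 (expf_neq0 2 a0) f0) => b0.
  by rewrite E b0 expr0n mul0r eqxx.
have [i [a' [na Ea]]] := factor_out a0; have [j [b' [nb Eb]]] := factor_out b0.
have nc : ~~ (g %| c%:P).
  by rewrite -irredp_coprimep -alg_polyC coprimepZr // coprimep1.
have := @factor_out_uniq (a' ^+ 2 * f') (b' ^+ 2 * c%:P) (2 * i + e) (2 * j).
rewrite !expr2 !irredp_dvdpM !negb_or na nb nf' nc => /(_ isT isT) H.
have : (2 * i + e = 2 * j)%N.
  apply: H; rewrite exprD !mul2n -!addnn !exprD; transitivity (alpha ^+ 2 * f).
    by rewrite Ea Ef; ring.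
  by rewrite E Eb; ring.
by move/(congr1 odd); rewrite oddD !mul2n !odd_double odd_e.
Qed.

End IrreducibleFactor.

(** * Nonvanishing of the auxiliary polynomial and the resulting count *)

Lemma horner_Xn_inj (F : fieldType) (Q : nat) (B : {poly {poly F}}) :
  (forall j, size (B`_j)%R <= Q)%N -> B.['X^Q] = 0 -> B = 0.
Proof.
elim/poly_ind: B => [//|B c IHB] sB.
have sc : (size c <= Q)%N by have := sB 0; rewrite coefD coefMX coefC add0r.
rewrite hornerMXaddC => E.
have sB' j : (size (B`_j)%R <= Q)%N by have := sB j.+1; rewrite coefD coefMX coefC addr0.
(* Terms attached to distinct powers of X^Q cannot cancel: if B(X^Q) were nonzero, [c] would be
   -B(X^Q) X^Q, whose size exceeds [Q]. *)
have [/(IHB sB') B0|nz] := eqVneq B.['X^Q] 0.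
  by move: E; rewrite B0 horner0 mul0r add0r => ->; rewrite mul0r addr0.
have : size (B.['X^Q] * 'X^Q) = size c.
  by rewrite -(addr0_eq E) size_polyN.
have : size B.['X^Q] != 0 by rewrite size_poly_eq0.
by rewrite size_mulXn // addnC; lia.
Qed.

Lemma size_coefM_leq (F : fieldType) (m n : nat) (B C : {poly {poly F}}) :
  (forall j, size (B`_j)%R <= m.+1)%N -> (forall j, size (C`_j)%R <= n.+1)%N ->
  forall j, (size ((B * C)%R`_j)%R <= (m + n).+1)%N.
Proof.
move=> sB sC j; rewrite coefM.
apply: (leq_trans (size_sum _ _ _)); apply/bigmax_leqP => i _.
apply: (leq_trans (size_polyMleq _ _)).
by have := sB i; have := sC (j - i)%N; lia.
Qed.

Lemma poly_of_ord (R : nzRingType) (J : nat) (a : 'I_J -> R) :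
  exists P : {poly R},
    [/\ forall j : 'I_J, P`_j = a j, forall j, (J <= j)%N -> P`_j = 0
      & forall x, P.[x] = \sum_(j < J) a j * x ^+ j].
Proof.
exists (\poly_(j < J) (if insub j is Some i then a i else 0)); split.
- by move=> j; rewrite coef_poly ltn_ord valK.
- by move=> j leJj; rewrite coef_poly ltnNge leJj.
by move=> x; rewrite horner_poly; apply: eq_bigr => i _; rewrite valK.
Qed.

Section Stepanov.
Variables (F : finFieldType) (f g : {poly F}) (D e h : nat).
Hypotheses (qE : #|F| = (2 * h + 1)%N) (sf : (size f <= D.+1)%N).
Hypotheses (g_irr : irreducible_poly g) (e_odd : odd e).
Hypothesis g_mult : has_multiplicity g f e.
Local Notation q := #|F|.

Lemma stepanov_independent (A J : nat) (a b : 'I_J -> {poly F}) :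
  (2 * A + D < q)%N ->
  (forall j, size (a j) <= A.+1)%N -> (forall j, size (b j) <= A.+1)%N ->
  \sum_j a j * 'X^(q * j) + \sum_j b j * ('X^(q * j) * f ^+ h) = 0 ->
  forall j, a j = 0 /\ b j = 0.
Proof.
move=> ltAq sa sb E.
have [P [Pa Pbig PX]] := poly_of_ord a; have [Q [Qb Qbig QX]] := poly_of_ord b.
have sP j : (size (P`_j)%R <= A.+1)%N.
  by have [lt|/Pbig->] := ltnP j J; [rewrite (Pa (Ordinal lt)) | rewrite size_poly0].
have sQ j : (size (Q`_j)%R <= A.+1)%N.
  by have [lt|/Qbig->] := ltnP j J; [rewrite (Qb (Ordinal lt)) | rewrite size_poly0].
have {}E : P.['X^q] = - (Q.['X^q] * f ^+ h).
  apply/eqP; rewrite -addr_eq0 -[X in _ == X]E PX QX mulr_suml; apply/eqP.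
  by congr (_ + _); apply: eq_bigr => j _; rewrite -exprM ?mulrA.
have f0 : f != 0.
  by case/andP: g_mult => _; apply: contraNneq => ->; rewrite dvdp0.
(* Here [f%:P] is f(X) and [f^:P] is f(Y). At Y = X^q the identity comes from squaring [E] and
   multiplying by [f], since f^(2h+1) = f^q = f(X^q). As 2A + D < q, all X-degrees are below q, and
   Y may be treated as independent. *)
have PQ : P ^+ 2 * f%:P = Q ^+ 2 * f^:P.
  apply/eqP; rewrite -subr_eq0; apply/eqP; apply: (@horner_Xn_inj _ q) => [j|].
    rewrite coefB; apply: (leq_trans (size_polyD _ _)); rewrite size_polyN geq_max.
    apply/andP; split; apply: leq_trans (_ : _ <= (A + A + D).+1)%N _; try lia.
      apply: size_coefM_leq; first by rewrite expr2; exact: size_coefM_leq.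
      by move=> k; rewrite coefC; case: eqP; rewrite ?size_poly0.
    apply: size_coefM_leq; first by rewrite expr2; exact: size_coefM_leq.
    move=> k; rewrite coef_map /=; exact: leq_trans (size_polyC_leq1 _) _.
  rewrite hornerD hornerN !expr2 !hornerM hornerC E.
  have -> : (f^:P).['X^q] = f ^+ h * f ^+ h * f.
    by rewrite -[LHS]/(f \Po 'X^q) -expr_card_poly qE -exprD -exprSr; congr (_ ^+ _); lia.
  ring.
(* Leading coefficients in Y would give alpha^2 f = beta^2 c with c a nonzero constant, against the
   odd multiplicity of [g]. *)
have P0 : P = 0.
  apply/eqP; apply: contraT => P0; have := congr1 lead_coef PQ.
  rewrite !lead_coefM -!expr2 lead_coefC.
  rewrite lead_coef_map_inj //; last exact: polyC_inj.
  move=> K; exfalso; apply: (odd_multiplicity_not_square g_irr e_odd g_mult _ _ K).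
    by rewrite lead_coef_eq0.
  by rewrite lead_coef_eq0.
have Q0 : Q = 0.
  apply/eqP; move/esym/eqP: PQ; rewrite P0 expr0n mul0r mulf_eq0 expf_eq0 /=.
  by rewrite map_polyC_eq0 (negPf f0) orbF.
by move=> j; rewrite -Pa -Qb P0 Q0 !coef0.
Qed.

(** The combination is nonzero by independence and vanishes to order [s] on the set, so its degree
    bounds the cardinality. The last hypothesis compares the number of linear conditions with the
    2J(A + 1) free coefficients. *)
Lemma stepanov_bound (A J s : nat) (eps : F) :
  eps != 0 -> (s <= q)%N -> (0 < J)%N -> (2 * A + D < q)%N ->
  (s * (A.+1 + J + s * D) < (J + J) * A.+1)%N ->
  (#|[set x | f.[x] ^+ h == eps]| * s < A.+1 + q * J.-1 + D * h)%N.
Proof.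
move=> eps0 lesq J0 ltAq ltcount; set S := [set x | _].
(* On the set, X^(qj) takes the values of X^j because x^q = x, and [f ^+ h] those of [eps]; [v]
   collects these low-degree substitutes. *)
pose w i : {poly F} := match split (i : 'I_(J + J)) with
  | inl j => 'X^(q * j) | inr j => 'X^(q * j) * f ^+ h end.
pose v i : {poly F} := match split (i : 'I_(J + J)) with
  | inl j => 'X^j | inr j => eps *: 'X^j end.
have hh : (0 < h)%N by have := finNzRing_gt1 F; rewrite qE; lia.
have hw i : log_hasse f D s (w i).
  rewrite /w; case: split => j; first exact: log_hasse_Xcard.
  apply: log_hasseM; first exact: log_hasse_Xcard.
  by apply: log_hasseX; exact: log_hasse_self.
have hv i : (size (v i) <= J)%N.
  rewrite /v; case: split => j; last rewrite size_scale //.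
    by rewrite size_polyXn.
  by rewrite size_polyXn.
have hS x : x \in S -> f.[x] != 0 /\ forall i, (w i).[x] = (v i).[x].
  rewrite inE => /eqP fx; split.
    by apply: contraNneq eps0 => fx0; rewrite -fx fx0 expr0n gtn_eqF.
  by move=> i; rewrite /w /v; case: split => j;
    rewrite !(hornerZ, hornerM, hornerXn, horner_exp) exprM expf_card // fx mulrC.
have [a [[i ai0] sa dvd]] :=
  @auxiliary_poly F (J + J) A.+1 D J s f w v (mem S) sf hw hv hS ltcount.
set P := \sum_i a i * w i in dvd.
have PE : P = \sum_j a (lshift J j) * 'X^(q * j)
            + \sum_j a (rshift J j) * ('X^(q * j) * f ^+ h).
  rewrite /P big_split_ord; congr (_ + _); apply: eq_bigr => j _; congr (_ * _).
    by rewrite /w; case: split_ordP => k E; rewrite ?(lshift_inj E) //; move/eqP: E; rewrite eq_lrshift.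
  by rewrite /w; case: split_ordP => k E; rewrite ?(rshift_inj E) //; move/eqP: E; rewrite eq_rlshift.
have P0 : P != 0.
  apply: contra_neq ai0 => P0; rewrite P0 in PE.
  have ind := stepanov_independent ltAq (fun j => sa _) (fun j => sa _) (esym PE).
  by case: (split_ordP i) => j ->; case: (ind j).
apply: (leq_trans (card_mul_leq_size P0 dvd)).
apply: (leq_trans (size_sum _ _ _)); apply/bigmax_leqP => k _.
apply: (leq_trans (size_polyMleq _ _)).
have : (size (w k) <= (q * J.-1 + D * h).+1)%N.
  have leqj (j : 'I_J) : (q * j <= q * J.-1)%N by rewrite leq_mul2l -ltnS prednK // ltn_ord orbT.
  rewrite /w; case: split => j; have := leqj j; first by rewrite size_polyXn; lia.
  move=> le1; apply: (leq_trans (size_polyMleq _ _)); rewrite size_polyXn.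
  have := size_poly_exp_leq f h.
  have : ((size f).-1 * h <= D * h)%N by rewrite leq_mul2r; lia.
  by move: ((size f).-1 * h)%N; lia.
by have := sa k; move: (size (a k)) (size (w k)) => u t; lia.
Qed.

(** Takes J near s/2, with s of the order of sqrt q. The main part qs/2 of the degree, divided by s,
    gives q/2; the rest is O(Dq) = O(D s^2). *)
Lemma stepanov_count (s : nat) (eps : F) :
  eps != 0 -> (0 < D)%N -> (s * s <= q)%N -> (q <= 4 * (s * s))%N ->
  (2 * #|[set x | f.[x] ^+ h == eps]| <= q + 80 * (D * s))%N.
Proof.
move=> eps0 D0 les geS; set N := #|_|.
have leNq : (N <= q)%N by exact: max_card.
have s0 : (0 < s)%N by case: s geS {les} => //; have := finNzRing_gt1 F; lia.
(* For q < 2D or s < 8, the trivial bound by q suffices. *)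
have [ltq|leq2D] := ltnP q (2 * D)%N.
  by have := leq_pmulr D s0; lia.
have [lts|les8] := ltnP s 8.
  have : (s * s <= 7 * s)%N by rewrite leq_mul2r -ltnS lts orbT.
  by have := leq_pmull s D0; lia.
(* The largest A with 2A + D < q; since q is at least 2D, A + 1 is at least q/4. *)
have ltAq : (2 * (q - D - 1)./2 + D < q)%N by lia.
have geA : (q <= 4 * (q - D - 1)./2.+1)%N by lia.
have ltA : ((q - D - 1)./2.+1 <= q)%N by lia.
move: (q - D - 1)./2 ltAq geA ltA => A ltAq geA ltA.
(* J must slightly exceed s / 2: the excess 8 D pays for the terms s J and s ^ 2 D. *)
have [J [geJ leJ]] : exists J, (s + 16 * D <= 2 * J)%N /\ (2 * J <= s + 16 * D + 1)%N.
  by exists (s + 16 * D + 1)./2; lia.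
have J0 : (0 < J)%N by lia.
have lesq : (s <= q)%N by have := leq_pmulr s s0; lia.
have ltcount : (s * (A.+1 + J + s * D) < (J + J) * A.+1)%N.
  have h1 : ((s + 16 * D) * A.+1 <= (J + J) * A.+1)%N by rewrite leq_mul2r; lia.
  have h2 : (D * q <= D * (4 * A.+1))%N by rewrite leq_mul2l geA orbT.
  have h3 : (s * s * D <= q * D)%N by rewrite leq_mul2r les orbT.
  have h4 : (s * (2 * J) <= s * (s + 16 * D + 1))%N by rewrite leq_mul2l leJ orbT.
  have h5 : (8 * (D * s) <= s * (D * s))%N by rewrite leq_mul2r les8 orbT.
  have h6 : (q <= D * q)%N by rewrite leq_pmull.
  by lia.
have := stepanov_bound eps0 lesq J0 ltAq ltcount; rewrite -/N => bd.
have b1 : (q * J = q + q * J.-1)%N by rewrite -mulnS prednK.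
have b2 : (D * q = 2 * (D * h) + D)%N by rewrite qE; lia.
have b3 : (q * (2 * J) <= q * (s + 16 * D + 1))%N by rewrite leq_mul2l leJ orbT.
have b4 : (q * D <= 4 * (s * s) * D)%N by rewrite leq_mul2r geS orbT.
have b5 : (q <= D * q)%N by rewrite leq_pmull.
by rewrite -(leq_pmul2r s0); lia.
Qed.

End Stepanov.

(** * Quadratic character sums *)

Section QuadraticCharacter.
Variable F : finFieldType.
Hypothesis q_odd : odd #|F|.

Let h := #|F|./2.

Lemma card_half : #|F| = (2 * h + 1)%N.
Proof. by rewrite -[LHS]odd_double_half q_odd mul2n addnC. Qed.

Lemma half_gt0 : (0 < h)%N.
Proof. by have := finNzRing_gt1 F; rewrite card_half; lia. Qed.

Lemma two_neq0 : (2 : F) != 0.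
Proof.
have : 'C(#|F|, 1)%:R = 0 :> F by apply: bin_card_eq0; exact: finNzRing_gt1.
by rewrite bin1 card_half natrD natrM; apply: contra_eq_neq => ->; rewrite mul0r add0r oner_neq0.
Qed.

Lemma expf_half (x : F) : x != 0 -> x ^+ (2 * h) = 1.
Proof.
by move=> x0; apply: (mulIf x0); rewrite mul1r -exprSr -addn1 -card_half expf_card.
Qed.

(** The multiplicative group is cyclic: if x = z^i with z a generator, then 2h divides ih, so i is
    even. *)
Lemma half_root_square (x : F) : x ^+ h = 1 -> exists y, y ^+ 2 == x.
Proof.
move=> xh; have h2 : (0 < 2 * h)%N by have := half_gt0; lia.
have : has (2 * h).-primitive_root (enum (predC1 (0 : F))).
  apply: has_prim_root; rewrite ?enum_uniq //.
    by apply/allP => y; rewrite mem_enum unity_rootE => /expf_half->.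
  by rewrite -cardE cardC1 card_half addn1.
case/hasP=> z _ z_prim.
have x1 : x ^+ (2 * h) = 1 by rewrite mulnC exprM xh expr1n.
have [i xE] := prim_rootP z_prim x1.
move: xh; rewrite xE -exprM => /eqP; rewrite -(prim_order_dvd z_prim).
rewrite dvdn_pmul2r ?half_gt0 // => /dvdnP[j ->].
by exists (z ^+ j); rewrite -exprM.
Qed.

(** Euler's criterion; for a nonsquare, x^h is a root of T^2 - 1 other than 1. *)
Lemma quad_charE (x : F) : (quad_char x)%:~R = x ^+ h :> F.
Proof.
rewrite /quad_char; have [->|x0] := eqVneq x 0; first by rewrite expr0n gtn_eqF // half_gt0.
case: existsP => [[y /eqP xy]|nsq].
  have y0 : y != 0 by apply: contraNneq x0 => y0; rewrite -xy y0 expr0n.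
  by rewrite -xy -exprM expf_half.
have : (x ^+ h - 1) * (x ^+ h + 1) = 0.
  by rewrite -subr_sqr expr1n -exprM mulnC expf_half // subrr.
move/eqP; rewrite mulf_eq0 subr_eq0 addr_eq0 => /orP[/eqP xh|/eqP->]; last by rewrite mulrN1z.
by case: nsq; exact: half_root_square.
Qed.

Lemma quad_char_cases (x : F) : [\/ quad_char x = 0, quad_char x = 1 | quad_char x = -1].
Proof. by rewrite /quad_char; do 2?case: ifP => _; [constructor 1|constructor 2|constructor 3]. Qed.

Lemma one_neqN1 : (1 : F) == -1 = false.
Proof. by apply/negbTE; rewrite -addr_eq0 two_neq0. Qed.

(** Multiplicativity of x^h lifts to the integers, because 0, 1 and -1 are distinct in [F]. *)
Lemma quad_charM : {morph @quad_char F : x y / x * y >-> x * y}.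
Proof.
move=> x y; have : (quad_char (x * y))%:~R = (quad_char x)%:~R * (quad_char y)%:~R :> F.
  by rewrite !quad_charE exprMn.
have oN := one_neqN1; have o0 := oner_eq0 F.
have No : (-1 : F) == 1 = false by rewrite eq_sym.
case: (quad_char_cases (x * y)) => ->; case: (quad_char_cases x) => ->;
  case: (quad_char_cases y) => -> //=; rewrite ?(mulr0z, mulr1z, mulrN1z, mul0r, mulr0, mul1r, mulr1, mulrNN, mulrN1) => /eqP;
  by rewrite ?(oppr_eq0, o0, oN, No, eq_sym 0).
Qed.

Lemma quad_char1 : quad_char (1 : F) = 1.
Proof.
rewrite /quad_char oner_eq0; case: existsP => // [[]].
by exists 1; rewrite expr1n.
Qed.

Lemma quad_char_prod (I : Type) (r : seq I) (P : pred I) (u : I -> F) :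
  quad_char (\prod_(i <- r | P i) u i) = \prod_(i <- r | P i) quad_char (u i).
Proof. exact: (big_morph _ quad_charM quad_char1). Qed.

(** The sum is N1 - N2, where N0 + N1 + N2 = q and N0 is at most D. Upper bounds q/2 + 40Ds on both
    N1 and N2 therefore bound the difference from both sides; 81 is 80 plus 1 for the zeros. *)
Lemma char_sum_bound (f g : {poly F}) (D e s : nat) :
  (0 < D)%N -> (size f <= D.+1)%N -> irreducible_poly g -> odd e ->
  has_multiplicity g f e -> (s * s <= #|F|)%N -> (#|F| <= 4 * (s * s))%N ->
  `|\sum_x quad_char f.[x]| <= (81 * (D * s))%N%:Z.
Proof.
move=> D0 sf g_irr e_odd g_mult les geS.
have cnt eps := stepanov_count card_half sf g_irr e_odd g_mult (s := s) (eps := eps).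
have oneN0 : -1 != 0 :> F by rewrite oppr_eq0 oner_neq0.
have := cnt 1 (oner_neq0 F) D0 les geS; have := cnt (-1) oneN0 D0 les geS.
set N2 := #|_|; set N1 := #|_|.
pose N0 := #|[set x | f.[x] == 0]|.
have f0 : f != 0.
  by case/andP: g_mult => _; apply: contraNneq => ->; rewrite dvdp0.
have leN0 : (N0 * 1 < size f)%N.
  by apply: card_mul_leq_size => // x; rewrite inE expr1 dvdp_XsubCl.
have oN := one_neqN1; have o0 := oner_eq0 F.
have No : (-1 : F) == 1 = false by rewrite eq_sym.
have cases x : (quad_char f.[x] = (f.[x] ^+ h == 1)%:R - (f.[x] ^+ h == -1)%:R)
    /\ ((f.[x] == 0)%R + (f.[x] ^+ h == 1)%R + (f.[x] ^+ h == -1)%R = 1)%N.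
  have := quad_charE f.[x]; have [->|fx0] := eqVneq f.[x] 0.
    by rewrite expr0n (gtn_eqF half_gt0) (eq_sym 0) o0 (eq_sym 0) oppr_eq0 o0 /quad_char eqxx.
  move: (expf_neq0 h fx0).
  by case: (quad_char_cases f.[x]) => -> nz E; move: nz; rewrite -E
     ?(mulr0z, mulr1z, mulrN1z, eqxx, oN, No, subr0, sub0r).
have card_sum (P : pred F) : #|[set x | P x]| = (\sum_x (P x : nat))%N.
  by rewrite -sum1_card big_mkcond; apply: eq_bigr => x _; rewrite inE; case: (P x).
have qE : (#|F| = N0 + N1 + N2)%N.
  rewrite /N0 /N1 /N2 !card_sum -!big_split -sum1_card.
  by apply: eq_bigr => x _; rewrite /= (cases x).2.
have -> : \sum_x quad_char f.[x] = N1%:Z - N2%:Z.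
  rewrite /N1 /N2 !card_sum -![(_%:Z)]natz !natr_sum -sumrB.
  by apply: eq_bigr => x _; rewrite (cases x).1.
by move: (D * s)%N (leq_pmulr D (n := s)) => Ds; lia.
Qed.

End QuadraticCharacter.

(** * Products of iterates and sign patterns *)

Lemma size_prod_leq_sum (F : fieldType) (I : Type) (r : seq I) (P : pred I)
    (u : I -> {poly F}) (b : I -> nat) :
  (forall i, size (u i) <= (b i).+1)%N ->
  (size (\prod_(i <- r | P i) u i)%R <= (\sum_(i <- r | P i) b i).+1)%N.
Proof.
move=> sb; elim/big_rec2: _ => [|i m p _ IHp]; first by rewrite size_poly1.
apply: (leq_trans (size_polyMleq _ _)).
by have := sb i; move: (size (u i)) (size p) IHp => x y; lia.
Qed.

Lemma has_multiplicityM (F : fieldType) (g f p : {poly F}) e :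
  irreducible_poly g -> has_multiplicity g f e -> ~~ (g %| p) ->
  has_multiplicity g (f * p) e.
Proof.
move=> g_irr /andP[dvd ndvd] np; rewrite /has_multiplicity dvdp_mulr //=.
by rewrite Gauss_dvdpl // coprimep_expl // irredp_coprimep.
Qed.

(** The factor [g] attached to the largest index of [I] divides no earlier iterate, so its
    multiplicity in the product is the one it has in the last iterate. *)
Lemma ordinary_prod_odd_multiplicity (F : fieldType) (f : {poly F}) (k : nat) (I : {set 'I_k}) :
  dynamically_2_ordinary f -> I != set0 ->
  exists g e, [/\ irreducible_poly g, odd e
    & has_multiplicity g (\prod_(i in I) poly_iter f i.+1) e].
Proof.
move=> ord_f /set0Pn[i0 i0I].
have [n nI nmax] := arg_maxnP (fun i : 'I_k => i : nat) i0I.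
have [g [g_irr _ [e e_odd g_mult] ng]] := ord_f n.+1 isT.
exists g, e; split=> //; rewrite (bigD1 n) //=; apply: has_multiplicityM => //.
apply: (big_ind (fun p => ~~ (g %| p))) => [|p p' np np'|i /andP[iI ni]].
- by rewrite -irredp_coprimep // coprimep1.
- by rewrite irredp_dvdpM // negb_or np.
by apply: (ng i.+1); rewrite ltnS ltn_neqAle [_ != _]ni; exact: nmax.
Qed.

Lemma size_poly_iter (F : fieldType) (f : {poly F}) d n :
  size f = d.+1 -> (size (poly_iter f n) <= (d ^ n).+1)%N.
Proof.
move=> sf; elim: n => [|n IHn]; first by rewrite size_polyX.
apply: (leq_trans (size_comp_poly_leq _ _)); rewrite sf /= ltnS expnS leq_mul2l.
by apply/orP; right; move: IHn; case: (size _).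
Qed.

Lemma sum_expn_leq (d k : nat) : (2 <= d)%N -> (\sum_(i < k) d ^ i.+1 <= 2 * d ^ k)%N.
Proof.
move=> d2; elim: k => [|k IHk]; first by rewrite big_ord0.
rewrite big_ord_recr /=; have : (2 * d ^ k <= d ^ k.+1)%N by rewrite expnS leq_mul2r d2 orbT.
by move=> le2; apply: leq_trans (_ : _ <= d ^ k.+1 + d ^ k.+1)%N _; rewrite ?leq_add2r ?addnn ?mul2n // (leq_trans IHk).
Qed.

(** The product of the factors 1 + eps_i chi(u_i(x)) is 2^k on the counted set and nonnegative
    elsewhere. Expanding its sum over subsets, the empty set contributes q and every other one at
    most [E]. *)
Lemma pattern_bound (F : finFieldType) (k E : nat) (u : 'I_k -> {poly F}) (eps : 'I_k -> int) :
  odd #|F| -> (forall i, eps i = 1 \/ eps i = -1) ->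
  (forall I : {set 'I_k}, I != set0 ->
     `|\sum_x quad_char (\prod_(i in I) u i).[x]| <= E%:Z) ->
  (2 ^ k * #|[set x | [forall i, quad_char (u i).[x] == eps i]]| <= #|F| + 2 ^ k * E)%N.
Proof.
move=> q_odd eps1 hE; set T := [set x | _].
pose W := \sum_x \prod_i (eps i * quad_char (u i).[x] + 1).
have lower : (2 ^ k * #|T|)%N%:Z <= W.
  rewrite PoszM mulrC -natz -sum1_card natr_sum mulr_suml /W big_mkcond /=.
  apply: ler_sum => x _; case: ifP => [|_].
    rewrite inE mul1r => /forallP xT.
    rewrite (eq_bigr (fun=> 2)) => [|i _]; first by rewrite prodr_const card_ord -natz natrX.
    by rewrite (eqP (xT i)); case: (eps1 i) => ->.
  apply: prodr_ge0 => i _.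
  by case: (eps1 i) => ->; case: (quad_char_cases (u i).[x]) => ->.
have expand : W = \sum_(I : {set 'I_k})
    (\prod_(i in I) eps i) * \sum_x quad_char (\prod_(i in I) u i).[x].
  rewrite /W (eq_bigr _ (fun x _ => bigA_distr _ _ _ _)) exchange_big.
  apply: eq_bigr => I _; rewrite mulr_sumr; apply: eq_bigr => x _.
  rewrite horner_prod quad_char_prod // -big_split /= [RHS]big_mkcond.
  by apply: eq_bigr => i _; case: (i \in I).
have upper : W <= (#|F| + 2 ^ k * E)%N%:Z.
  rewrite expand (bigD1 set0) //= big_set0 mul1r.
  rewrite PoszD; apply: lerD.
    rewrite (eq_bigr (fun=> 1)) => [|x _]; last by rewrite big_set0 hornerC quad_char1.
    by rewrite sumr_const natz.
  apply: (@le_trans _ _ (\sum_(I : {set 'I_k} | I != set0) E%:Z)).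
    apply: ler_sum => I I0; apply: (le_trans (ler_norm _)); rewrite normrM.
    rewrite normr_prod big1 ?mul1r; first exact: hE.
    by move=> i _; case: (eps1 i) => ->; rewrite ?normrN normr1.
  rewrite sumr_const -mulr_natr -natz -natrM -natz ler_nat mulnC leq_mul2r.
  have : (#|{set 'I_k}| = 2 ^ k)%N by rewrite -cardsT -powersetT card_powerset cardsT card_ord.
  by move=> <-; rewrite max_card orbT.
by rewrite -lez_nat; exact: le_trans lower upper.
Qed.

(** Each product has degree at most d + ... + d^k, hence at most 2d^k, which turns 81 into 162. *)
Lemma ordinary_pattern_bound (F : finFieldType) (f : {poly F}) (d k s : nat) (eps : 'I_k -> int) :
  (2 <= d)%N -> odd #|F| -> size f = d.+1 -> dynamically_2_ordinary f ->
  (s * s <= #|F|)%N -> (#|F| <= 4 * (s * s))%N -> (forall i, eps i = 1 \/ eps i = -1) ->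
  (2 ^ k * #|[set x | [forall i : 'I_k, quad_char (poly_iter f i.+1).[x] == eps i]]|
     <= #|F| + 2 ^ k * (162 * (d ^ k * s)))%N.
Proof.
move=> d2 q_odd sf ord_f les geS eps1; apply: pattern_bound => // I I0.
have [g [e [g_irr e_odd g_mult]]] := ordinary_prod_odd_multiplicity ord_f I0.
have -> : (162 * (d ^ k * s) = 81 * (2 * d ^ k * s))%N by lia.
apply: (char_sum_bound q_odd _ _ g_irr e_odd g_mult) => //.
  by rewrite muln_gt0 expn_gt0 (ltnW d2).
apply: (leq_trans (size_prod_leq_sum _ _ (fun i : 'I_k => size_poly_iter i.+1 sf))).
rewrite ltnS; apply: leq_trans (sum_expn_leq k d2).
by rewrite [leqRHS](bigID (mem I)) /= leq_addr.
Qed.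

(** * Orbits *)

Lemma is_periodD (T : Type) (s : nat -> T) (m l j : nat) :
  is_period s m -> (0 < l)%N -> s (l + j * m)%N = s l.
Proof.
case=> _ per l0; elim: j => [|j IHj]; first by rewrite addn0.
by rewrite mulSn addnCA addnC per ?IHj // addn_gt0 l0.
Qed.

Lemma card_orbit_leq (T : finType) (f : T -> T) (x : T) (i j : nat) :
  (i < j)%N -> iter j f x = iter i f x -> (#|fingraph.orbit f x| <= j)%N.
Proof.
move=> ltij E; rewrite (card_uniqP (orbit_uniq f x)) size_orbit leqNgt; apply/negP => ltj.
have lti := ltn_trans ltij ltj.
have := nth_uniq x _ _ (orbit_uniq f x); rewrite size_orbit => /(_ j i ltj lti).
by rewrite !nth_traject // E eqxx (gtn_eqF ltij).
Qed.

(** Division of the index by [m] writes each orbit point as an iterate, fewer than [m] steps on, of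
    a point of [S]. *)
Lemma card_orbit_leq_cover (T : finType) (f : T -> T) (x : T) (m : nat) (S : {set T}) :
  (0 < m)%N -> (forall j, iter (j * m) f x \in S) -> (#|fingraph.orbit f x| <= m * #|S|)%N.
Proof.
move=> m0 hS; pose g (p : 'I_m * T) := iter p.1 f p.2.
have -> : (m * #|S| = #|setX [set: 'I_m] S|)%N by rewrite cardsX cardsT card_ord.
apply: (leq_trans _ (leq_imset_card g _)); apply/subset_leq_card/subsetP => y.
case/trajectP=> i _ ->; apply/imsetP.
exists (Ordinal (ltn_pmod i m0), iter (i %/ m * m) f x); first by rewrite !inE hS.
by rewrite /g /= -iterD addnC -divn_eq.
Qed.

(** For the integer square root s, q < (s + 1)^2, which is at most 4s^2. *)
Lemma exists_isqrt (q : nat) : (0 < q)%N -> exists s, (s * s <= q)%N /\ (q <= 4 * (s * s))%N.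
Proof.
move=> q0; have ex : exists s, (s * s <= q)%N by exists 0%N.
have [|s les smax] := ex_maxnP (m := q) ex.
  by case=> // s; apply: leq_trans; exact: leq_pmulr.
exists s; split=> //; have s0 : (0 < s)%N by have := smax 1%N q0.
have : (q < s.+1 * s.+1)%N by rewrite ltnNge; apply/negP => /smax; rewrite ltnn.
by have := leq_pmulr s s0; lia.
Qed.

(** [k] is the largest exponent with (2d)^k at most s, where s is about sqrt q. The first bound
    saves a factor 2^k; the second ensures that this factor is at least a constant times a power of
    q. *)
Lemma orbit_bound (F : finFieldType) (f : {poly F}) (a : F) (d m : nat) :
  (2 <= d)%N -> odd #|F| -> size f = d.+1 -> dynamically_2_ordinary f ->
  is_period (fun l : nat => quad_char (poly_iter f l).[a]) m ->
  exists k, (2 ^ k * #|fingraph.orbit (horner f) a| <= 163 * (m * #|F|))%N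
    /\ (#|F| <= 4 * (2 * d) ^ (2 * k.+1))%N.
Proof.
move=> d2 q_odd sf ord_f per; have [m0 _] := per.
have q0 : (0 < #|F|)%N by have := finNzRing_gt1 F; lia.
have [s [les geS]] := exists_isqrt q0.
have s0 : (0 < s)%N by case: s geS {les} => //; lia.
have d2_gt1 : (1 < 2 * d)%N by lia.
have /andP[leks ltsk] := trunc_log_bounds d2_gt1 s0.
set k := trunc_log _ _ in leks ltsk *; exists k; split; last first.
  apply: (leq_trans geS); rewrite leq_mul2l /=.
  have -> : ((2 * d) ^ (2 * k.+1) = (2 * d) ^ k.+1 * (2 * d) ^ k.+1)%N.
    by rewrite -expnD addnn -mul2n.
  by apply: leq_mul; exact: ltnW.
have le2k : (2 ^ k <= s)%N.
  by apply: leq_trans leks; rewrite expnMn leq_pmulr // expn_gt0 (ltnW d2).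
have [/existsP[i /eqP si0]|nz] := boolP [exists i : 'I_k, quad_char (poly_iter f i.+1).[a] == 0].
  have char0 (x : F) : quad_char x = 0 -> x = 0.
    by rewrite /quad_char; case: eqP => // _; case: ifP.
  (* The index of the zero reduced modulo [m] into 1, ..., m, so that periodicity still applies. The
     iterates [j] and [j + m] of [a] both vanish, and the orbit has at most 2m points. *)
  pose j := (i %% m).+1.
  have sj0 : quad_char (poly_iter f j).[a] = 0.
    by rewrite -(is_periodD (i %/ m) per (ltn0Sn (i %% m))) addSn addnC -divn_eq.
  have sjm0 : quad_char (poly_iter f (j + m)).[a] = 0 by rewrite per.2.
  have E : iter (j + m) (horner f) a = iter j (horner f) a.
    by rewrite -!horner_poly_iter (char0 _ sj0) (char0 _ sjm0).
  have ltj : (j < j + m)%N by rewrite -[ltnLHS]addn0 ltn_add2l.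
  have := card_orbit_leq ltj E; have := ltn_pmod i m0; rewrite -/j => lej leo.
  have : (2 ^ k * #|fingraph.orbit (horner f) a| <= s * (m + m))%N.
    by apply: leq_mul => //; apply: leq_trans leo _; rewrite leq_add2r.
  have := leq_pmulr s s0; have : (s * m <= s * s * m)%N by rewrite leq_mul2r leq_pmulr ?orbT.
  have : (s * s * m <= #|F| * m)%N by rewrite leq_mul2r les orbT.
  by lia.
pose eps (i : 'I_k) := quad_char (poly_iter f i.+1).[a].
have eps1 i : eps i = 1 \/ eps i = -1.
  move: nz; rewrite negb_exists => /forallP/(_ i); rewrite -/(eps i).
  by rewrite /eps; case: (quad_char_cases (poly_iter f i.+1).[a]) => ->; [| left | right].
have := ordinary_pattern_bound d2 q_odd sf ord_f les geS eps1; set T := [set x | _] => Tbd.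
have cover j : iter (j * m) (horner f) a \in T.
  rewrite inE; apply/forallP => i; rewrite horner_poly_iter -iterD -horner_poly_iter.
  by apply/eqP; exact: (is_periodD j per (ltn0Sn i)).
have := card_orbit_leq_cover m0 cover => leo.
(* The choice of [k] makes the error harmless: (2d)^k s is at most s^2, hence at most q. *)
have dk : (2 ^ k * (162 * (d ^ k * s)) <= 162 * #|F|)%N.
  rewrite mulnCA leq_mul2l /= mulnA -expnMn; apply: leq_trans les.
  by rewrite leq_mul2r leks orbT.
have le1 : (2 ^ k * #|fingraph.orbit (horner f) a| <= 2 ^ k * (m * #|T|))%N by rewrite leq_mul2l leo orbT.
apply: (leq_trans le1); rewrite mulnCA [leqRHS]mulnCA leq_mul2l; apply/orP; right.
by apply: (leq_trans Tbd); lia.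
Qed.

(** * The exponent of q and the final estimate *)

Lemma powR_log2 (R : realType) (x : R) : 0 < x -> 2 `^ (log2 x) = x.
Proof.
move=> x0; have ln2 : ln 2 != 0 :> R by rewrite gt_eqF // ln_gt0 // ltr1n.
by rewrite /powR pnatr_eq0 /= /log2 divfK // lnK.
Qed.

(** With L = log2 d, 2d = 2^(1 + L), so raising (2d)^(2(k+1)) to the power 1/(2L + 2) gives exactly
    2^(k+1); the constant 4 stays at most 4. *)
Lemma powR_card_leq (R : realType) (d k q : nat) :
  (2 <= d)%N -> (q <= 4 * (2 * d) ^ (2 * k.+1))%N ->
  q%:R `^ (2 * log2 d%:R + 2)^-1 <= 8 * 2 ^+ k :> R.
Proof.
move=> d2 leq; set L := log2 _; set b := _^-1.
have L0 : 0 <= L.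
  by rewrite /L /log2 divr_ge0 // ln_ge0 // ler1n // ltnW.
have bE : (1 + L) * b * 2 = 1 by rewrite /b; field; lra.
have b0 : 0 <= b by rewrite /b invr_ge0; lra.
have b1 : b <= 1 by rewrite /b invf_le1; lra.
have dR : 0 < d%:R :> R by rewrite ltr0n ltnW.
have d2E : (2 * d)%:R = 2 `^ (1 + L) :> R.
  by rewrite powRD ?pnatr_eq0 ?implybT // powRr1 // powR_log2 // natrM.
have -> : 8 * 2 ^+ k = 4 * (2 ^+ k.+1) :> R by rewrite exprS; ring.
have le1 : q%:R <= 4 * (2 * d)%:R ^+ (2 * k.+1) :> R.
  by rewrite -natrX -natrM ler_nat.
apply: (le_trans (ge0_ler_powR b0 _ _ le1)); rewrite ?nnegrE ?mulr_ge0 ?exprn_ge0 //.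
rewrite powRM ?exprn_ge0 //; apply: ler_pM; rewrite ?powR_ge0 //.
  by apply: ler1_powR => //; rewrite ler1n.
rewrite d2E -!powR_mulrn ?powR_ge0 // -!powRrM.
have -> : (1 + L) * ((2 * k.+1)%:R * b) = k.+1%:R.
  by rewrite natrM; transitivity ((1 + L) * b * 2 * k.+1%:R); [ring | rewrite bE mul1r].
exact: lexx.
Qed.

Theorem theorem4p3 (R : realType) (d : nat) (d_ge2 : (2 <= d)%N) :
  exists2 C : R, 0 < C &
    forall (F : finFieldType) (f : {poly F}) (a : F) (m : nat),
      odd #|F| ->
      size f = d.+1 ->
      dynamically_2_ordinary f ->
      least_period (fun l : nat => quad_char (poly_iter f l).[a]) m ->
      #|fingraph.orbit (horner f) a|%:R <=
        C * (m%:R * #|F|%:R `^ ((2 * log2 d%:R + 1) / (2 * log2 d%:R + 2))).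
Proof.
(* 1304 = 8 * 163, the product of the constants in [powR_card_leq] and [orbit_bound]. *)
exists 1304 => [//|F f a m q_odd sf ord_f [per _]].
pose L : R := log2 d%:R; have L0 : 0 <= L.
  by rewrite /L /log2 divr_ge0 // ln_ge0 // ler1n // ltnW.
(* Writing the exponent as 1 - b turns the claim into a bound on the orbit size times q^b, where q^b
   is at most 8 * 2^k. *)
have -> : (2 * L + 1) / (2 * L + 2) = 1 - (2 * L + 2)^-1.
  by move: L L0; clear => L L0; field; lra.
have [k [leo leq]] := orbit_bound d_ge2 q_odd sf ord_f per.
have := powR_card_leq R d_ge2 leq; rewrite -/L; set b := _^-1 => leb.
have q0 : (0 < #|F|)%N by have := finNzRing_gt1 F; lia.
have qR : 0 < #|F|%:R :> R by rewrite ltr0n.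
rewrite powRD ?(gt_eqF qR) ?implybT // powRN powRr1 ?ler0n //.
rewrite !mulrA ler_pdivlMr ?powR_gt0 //.
have leoR : 2 ^+ k * #|fingraph.orbit (horner f) a|%:R <= 163 * (m%:R * #|F|%:R) :> R.
  by rewrite -natrX -!natrM ler_nat.
apply: (le_trans (ler_wpM2l (ler0n _ _) leb)); move: leoR.
set u : R := 2 ^+ k; set v : R := _%:R; set w : R := m%:R; set z : R := #|F|%:R.
by move: u v w z; clear => u v w z; lra.
Qed.
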